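(* Suppose $M$ is a model of GBC (not necessarily countable or transitive), $\mathbb P$ is a class forcing notion in $M$ that admits a forcing relation in $M$ for a first-order formula $\varphi$ which is standard in the meta-theory, in a forcing language with finitely many class names $\dot\Gamma_0,\ldots,\dot\Gamma_n$, and $G\subseteq\mathbb P$ is $M$-generic. Then for $\mathbb P$-names $\tau$ of $M$, $\langle M[G],\in_G,\Gamma_0,\ldots,\Gamma_n\rangle\models\varphi([\tau])$ if and only if there is $p\in G$ with $p\Vdash\varphi(\tau)$.
   Context: A class forcing notion is a separative class pre-order $\mathbb P$ with top $\mathbb 1$; a class name is a class of pairs $\langle\rho,p\rangle$ with $\rho$ a name, $p\in\mathbb P$. A forcing relation for $\varphi$ is a relation $\Vdash$ in $M$ defined on a subformula-closed collection of formulas containing all atomic formulas and all instances of $\varphi$, satisfying: $p\Vdash\sigma\in\tau$ iff densely many $q\le p$ have $\langle\rho,r\rangle\in\tau$ with $q\le r$, $q\Vdash\sigma=\rho$; $p\Vdash\sigma=\tau$ iff $p\Vdash\sigma\subseteq\tau$ and $p\Vdash\tau\subseteq\sigma$, where $p\Vdash\sigma\subseteq\tau$ iff whenever $\langle\rho,r\rangle\in\sigma$ and $q'\le p,r$ there is $q\le q'$ with $q\Vdash\rho\in\tau$; $p\Vdash\sigma\in\dot\Gamma$ iff densely many $q\le p$ have $\langle\tau,r\rangle\in\dot\Gamma$ with $q\le r$, $q\Vdash\sigma=\tau$; $p\Vdash\varphi\wedge\psi$ iff both; $p\Vdash\neg\varphi$ iff no $q\le p$ forces $\varphi$; $p\Vdash\forall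 x\,\varphi(x)$ iff $p\Vdash\varphi(\tau)$ for all names $\tau$. A filter $G\subseteq\mathbb P$ is $M$-generic if it meets every dense subclass of $\mathbb P$ in $M$. On names of $M$ define $\sigma=_G\tau$ iff $\exists p\in G\ p\Vdash\sigma=\tau$ and $\sigma\in_G\tau$ iff $\exists p\in G\ p\Vdash\sigma\in\tau$; $M[G]$ is the set of $=_G$-classes $[\sigma]$ with the induced relation $\in_G$, and for each class name $\dot\Gamma_i$, $\Gamma_i([\sigma])$ iff $\exists p\in G\ p\Vdash\sigma\in\dot\Gamma_i$. *)

(* Defs.v *)
From mathcomp Require Import all_boot.
Set Implicit Arguments.
Unset Strict Implicit.
Unset Printing Implicit Defensive.

(** Terms are variables [inl k], named by natural numbers, or constants [inr c];
    [Cls i t] says that t is an element of the i-th class. *)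
Definition term (C : Type) : Type := (nat + C)%type.

Inductive form (I C : Type) : Type :=
| Mem of term C & term C
| Eq of term C & term C
| Cls of I & term C
| And of form I C & form I C
| Neg of form I C
| All of nat & form I C.

Arguments Mem {I C}.
Arguments Eq {I C}.
Arguments Cls {I C}.
Arguments All {I C}.

Definition upd (T : Type) (e : nat -> T) (k : nat) (x : T) : nat -> T :=
  fun j => if j == k then x else e j.

Section Satisfaction.
Variables (I C D : Type) (mem : D -> D -> Prop) (cls : I -> D -> Prop).
Variable cst : C -> D.

Definition tval (e : nat -> D) (t : term C) : D :=
  match t with inl k => e k | inr c => cst c end.

Fixpoint sat (e : nat -> D) (f : form I C) : Prop :=
  match f with
  | Mem t u => mem (tval e t) (tval e u)
  | Eq t u => tval e t = tval e u
  | Cls i t => cls i (tval e t)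
  | And f g => sat e f /\ sat e g
  | Neg f => ~ sat e f
  | All k f => forall x : D, sat (upd e k x) f
  end.
End Satisfaction.

(** Only used to replace variables by constants or by themselves, so that no
    variable capture can occur. *)
Section Substitution.
Variables (I C C' : Type).

Definition tbind (s : nat -> term C') (c : C -> C') (t : term C) : term C' :=
  match t with inl k => s k | inr a => inr (c a) end.

Fixpoint fbind (s : nat -> term C') (c : C -> C') (f : form I C) :
    form I C' :=
  match f with
  | Mem t u => Mem (tbind s c t) (tbind s c u)
  | Eq t u => Eq (tbind s c t) (tbind s c u)
  | Cls i t => Cls i (tbind s c t)
  | And f g => And (fbind s c f) (fbind s c g)
  | Neg f => Neg (fbind s c f)
  | All k f => All k (fbind (upd s k (inl k)) c f)
  end.
End Substitution.

Definition inst (I C : Type) (s : nat -> C) (f : form I void) : form I C :=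
  fbind (fun k => inr (s k)) (fun v : void => match v with end) f.

Definition subst (I C : Type) (k : nat) (c : C) (f : form I C) : form I C :=
  fbind (upd inl k (inr c)) id f.

Record set_class_structure := SetClassStructure {
  vset :> Type;
  vclass : Type;
  sin : vset -> vset -> Prop;
  cin : vset -> vclass -> Prop
}.

Notation "x '\ins' y" := (sin x y) (at level 70, no associativity).
Notation "x '\inc' X" := (cin x X) (at level 70, no associativity).

Section SetNotions.
Variable M : set_class_structure.
Implicit Types (x y z u v e : M) (F : vclass M).

Definition is_empty x := forall z, ~ z \ins x.
Definition is_upair x y z := forall w, w \ins z <-> w = x \/ w = y.
Definition is_opair x y z :=
  exists u v, [/\ is_upair x x u, is_upair x y v & is_upair u v z].
Definition is_succ x y := forall w, w \ins y <-> w \ins x \/ w = x.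

Definition opair_ins x y z := exists2 w, is_opair x y w & w \ins z.
Definition opair_inc x y F := exists2 w, is_opair x y w & w \inc F.

Definition functional F :=
  forall x y y', opair_inc x y F -> opair_inc x y' F -> y = y'.
End SetNotions.

Record is_GBC (M : set_class_structure) : Prop := IsGBC {
  gbc_ext : forall x y : M, (forall z, z \ins x <-> z \ins y) -> x = y;
  gbc_cext : forall X Y : vclass M, (forall z, z \inc X <-> z \inc Y) -> X = Y;
  gbc_pairing : forall x y : M, exists z, is_upair x y z;
  gbc_union : forall x : M, exists y, forall z,
    z \ins y <-> exists2 w, w \ins x & z \ins w;
  gbc_power : forall x : M, exists y, forall z,
    z \ins y <-> forall w, w \ins z -> w \ins x;
  gbc_infinity : exists x : M,
    (exists2 z, is_empty z & z \ins x) /\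
    forall z, z \ins x -> exists2 w, is_succ z w & w \ins x;
  gbc_foundation : forall X : vclass M, (exists x, x \inc X) ->
    exists2 x, x \inc X & forall y, y \ins x -> ~ y \inc X;
  gbc_replacement : forall F : vclass M, functional F ->
    forall x : M, exists y, forall z,
      z \ins y <-> exists2 w, w \ins x & opair_inc w z F;
  (** [f] has only set quantifiers; its class parameters are the predicate
      symbols of the language, its set parameters are given by [e] *)
  gbc_comprehension : forall (f : form (vclass M) void) (e : nat -> M),
    exists X : vclass M, forall x, x \inc X <->
      sat (@sin M) (fun Y y => y \inc Y) (fun v : void => match v with end)
          (upd e 0 x) f;
  gbc_global_choice : exists2 F : vclass M, functional F &
    forall x : M, (exists y, y \ins x) -> exists2 y, y \ins x & opair_inc x y F
}.

Record GBC_model := GBCModel {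
  gbc_structure :> set_class_structure;
  gbc_axioms : is_GBC gbc_structure
}.

Record forcing_notion (M : GBC_model) := ForcingNotion {
  fcond : vclass M;
  forder : vclass M;
  ftop : M;
  fle := fun p q : M => opair_inc p q forder;
  forder_sub : forall z, z \inc forder ->
    exists p q, [/\ p \inc fcond, q \inc fcond & is_opair p q z];
  fle_refl : forall p, p \inc fcond -> fle p p;
  fle_trans : forall p q r, fle p q -> fle q r -> fle p r;
  ftop_cond : ftop \inc fcond;
  fle_top : forall p, p \inc fcond -> fle p ftop;
  fsep : forall p q, p \inc fcond -> q \inc fcond -> ~ fle p q ->
    exists2 r, fle r p & ~ exists s, fle s r /\ fle s q
}.

Section Names.
Variables (M : GBC_model) (P : forcing_notion M).

(** The usual recursion "a name is a set of pairs (rho, p) with rho a name and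
    p a condition" has to be carried out inside M, whose membership relation
    may be ill-founded: x is a name if it belongs to a set t of M all of whose
    elements are sets of pairs (rho, p) with rho in t and p a condition.  By
    foundation in M, this is the unique solution of the recursion. *)
Definition is_name (x : M) := exists t : M, x \ins t /\
  forall y, y \ins t -> forall z, z \ins y ->
    exists rho p, [/\ rho \ins t, p \inc fcond P & is_opair rho p z].

Definition name := {x : M | is_name x}.

Definition is_class_name (X : vclass M) := forall z, z \inc X ->
  exists (rho : name) p, p \inc fcond P /\ is_opair (sval rho) p z.

Definition class_name := {X : vclass M | is_class_name X}.
End Names.

Definition fform (M : GBC_model) (P : forcing_notion M) (n : nat) :=
  form 'I_n.+1 (name P).

Section Codes.
Variables (M : GBC_model) (P : forcing_notion M) (n : nat).

Fixpoint is_num (k : nat) (x : M) : Prop :=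
  if k is j.+1 then exists2 y, is_num j y & is_succ y x else is_empty x.

Definition tag (k : nat) (x z : M) := exists2 y, is_num k y & is_opair y x z.
Definition tag2 (k : nat) (x y z : M) := exists2 w, is_opair x y w & tag k w z.

Definition tcodes (t : term (name P)) (a : M) : Prop :=
  match t with
  | inl k => exists2 x, is_num k x & tag 0 x a
  | inr sigma => tag 1 (sval sigma) a
  end.

(** The set [a] of M is the code of the standard formula [f], natural numbers
    being represented by the von Neumann numerals of M. *)
Fixpoint codes (f : fform P n) (a : M) : Prop :=
  match f with
  | Mem t u => exists x y, [/\ tcodes t x, tcodes u y & tag2 0 x y a]
  | Eq t u => exists x y, [/\ tcodes t x, tcodes u y & tag2 1 x y a]
  | Cls i t => exists x y, [/\ is_num i x, tcodes t y & tag2 2 x y a]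
  | And f g => exists x y, [/\ codes f x, codes g y & tag2 3 x y a]
  | Neg f => exists2 x, codes f x & tag 4 x a
  | All k f => exists x y, [/\ is_num k x, codes f y & tag2 5 x y a]
  end.
End Codes.

Section ForcingRelation.
Variables (M : GBC_model) (P : forcing_notion M) (n : nat).
Variable Gamma : 'I_n.+1 -> class_name P.
Implicit Types (p q r : M) (sigma tau rho : name P) (f g : fform P n).
Local Notation "p <=P q" := (fle P p q) (at level 70).

Definition densely_below p (A : M -> Prop) :=
  forall q', q' <=P p -> exists2 q, q <=P q' & A q.

(** A relation in M between conditions and formulas is a class [R] of pairs
    (p, a), with [a] the code of a formula. *)
Definition rforces (R : vclass M) p f :=
  exists2 a, codes f a & opair_inc p a R.

Section Clauses.
Variable R : vclass M.
Local Notation "p ||- f" := (rforces R p f) (at level 75).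
Local Notation "[ 'c' sigma ]" := (inr sigma) (format "[ 'c'  sigma ]").

Definition forces_sub p sigma tau := forall rho r,
  opair_ins (sval rho) r (sval sigma) ->
  forall q', q' <=P p -> q' <=P r ->
  exists2 q, q <=P q' & q ||- Mem [c rho] [c tau].

Record is_forcing_relation (dom : fform P n -> Prop) : Prop := {
  fr_mem : forall p sigma tau, p \inc fcond P ->
    p ||- Mem [c sigma] [c tau] <->
    densely_below p (fun q => exists rho r,
      [/\ opair_ins (sval rho) r (sval tau), q <=P r &
          q ||- Eq [c sigma] [c rho]]);
  fr_eq : forall p sigma tau, p \inc fcond P ->
    p ||- Eq [c sigma] [c tau] <->
    forces_sub p sigma tau /\ forces_sub p tau sigma;
  fr_cls : forall p i sigma, p \inc fcond P ->
    p ||- Cls i [c sigma] <->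
    densely_below p (fun q => exists tau r,
      [/\ opair_inc (sval tau) r (sval (Gamma i)), q <=P r &
          q ||- Eq [c sigma] [c tau]]);
  fr_and : forall p f g, p \inc fcond P -> dom (And f g) ->
    p ||- And f g <-> (p ||- f) /\ (p ||- g);
  fr_neg : forall p f, p \inc fcond P -> dom (Neg f) ->
    p ||- Neg f <-> ~ exists2 q, q <=P p & q ||- f;
  fr_all : forall p k f, p \inc fcond P -> dom (All k f) ->
    p ||- All k f <-> forall tau, p ||- subst k tau f
}.
End Clauses.

(** Formulas of the forcing language are sentences, with names in place of
    free variables: the immediate subformulas of "for all x, f(x)" are the
    f(tau). *)
Record subformula_closed (dom : fform P n -> Prop) : Prop := {
  sc_andl : forall f g, dom (And f g) -> dom f;
  sc_andr : forall f g, dom (And f g) -> dom g;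
  sc_neg : forall f, dom (Neg f) -> dom f;
  sc_all : forall k f, dom (All k f) -> forall tau, dom (subst k tau f)
}.

Record contains_atomic (dom : fform P n -> Prop) : Prop := {
  ca_mem : forall sigma tau, dom (Mem (inr sigma) (inr tau));
  ca_eq : forall sigma tau, dom (Eq (inr sigma) (inr tau));
  ca_cls : forall i sigma, dom (Cls i (inr sigma))
}.

(** [fr_dom] consists of standard formulas only.  This loses nothing: the
    restriction to standard formulas of a forcing relation on a collection of
    formulas in the sense of M satisfies the same clauses, and [phi], hence
    each of its subformulas, is standard. *)
Record forcing_relation (phi : form 'I_n.+1 void) := ForcingRelation {
  fr_dom : fform P n -> Prop;
  fr_class : vclass M;
  fr_closed : subformula_closed fr_dom;
  fr_atomic : contains_atomic fr_dom;
  fr_inst : forall tau : nat -> name P, fr_dom (inst tau phi);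
  fr_clauses : is_forcing_relation fr_class fr_dom
}.

Definition forces phi (F : forcing_relation phi) p f :=
  rforces (fr_class F) p f.

Record is_filter (G : M -> Prop) : Prop := {
  filter_sub : forall p, G p -> p \inc fcond P;
  filter_nonempty : exists p, G p;
  filter_up : forall p q, G p -> p <=P q -> G q;
  filter_down : forall p q, G p -> G q ->
    exists r, [/\ G r, r <=P p & r <=P q]
}.

Definition dense (D : vclass M) :=
  (forall p, p \inc D -> p \inc fcond P) /\
  forall p, p \inc fcond P -> exists2 q, q \inc D & q <=P p.

Definition is_generic (G : M -> Prop) :=
  is_filter G /\ forall D : vclass M, dense D -> exists2 p, G p & p \inc D.

Section Extension.
Variables (phi : form 'I_n.+1 void) (F : forcing_relation phi).
Variable G : M -> Prop.

Definition eqG sigma tau :=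
  exists2 p, G p & forces F p (Eq (inr sigma) (inr tau)).
Definition memG sigma tau :=
  exists2 p, G p & forces F p (Mem (inr sigma) (inr tau)).
Definition clsG i sigma :=
  exists2 p, G p & forces F p (Cls i (inr sigma)).

(** The equivalence class of sigma is the predicate [eqG sigma]. *)
Definition extension := {X : name P -> Prop | exists sigma, X = eqG sigma}.

Definition ext_cls sigma : extension :=
  exist _ (eqG sigma) (ex_intro _ sigma erefl).

Definition ext_mem (X Y : extension) :=
  exists sigma tau, [/\ X = ext_cls sigma, Y = ext_cls tau & memG sigma tau].

Definition ext_pred i (X : extension) :=
  exists2 sigma, X = ext_cls sigma & clsG i sigma.

Definition ext_sat (e : nat -> extension) (f : form 'I_n.+1 void) :=
  sat ext_mem ext_pred (fun v : void => match v with end) e f.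
End Extension.
End ForcingRelation.

(* Main.v *)
(** The truth lemma is proved by induction on formulas, using that stronger
    conditions force more and that what is forced densely below p is forced by
    p.  For a negation, genericity is applied to the class of conditions
    deciding the formula; for "for all x, f(x)", to the class of conditions
    that force it or, for some name tau, have no extension forcing f(tau).
    That equality of names is forced to be reflexive and transitive is shown by
    induction on names, inside M since M may be ill-founded: the properties
    involved must be first-order definable over M with class parameters. *)
From mathcomp Require Import all_boot.
From mathcomp Require Import boolp zify.
Require Import Defs.
Set Implicit Arguments.
Unset Strict Implicit.
Unset Printing Implicit Defensive.

(** * Injective renaming of variables *)

Section Renaming.
Variables (I C D : Type) (mem : D -> D -> Prop) (cls : I -> D -> Prop).
Variables (cst : C -> D) (h : nat -> nat).

Definition trename (t : term C) : term C :=
  match t with inl k => inl (h k) | inr c => inr c end.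

Fixpoint frename (f : form I C) : form I C :=
  match f with
  | Mem t u => Mem (trename t) (trename u)
  | Eq t u => Eq (trename t) (trename u)
  | Cls i t => Cls i (trename t)
  | And f g => And (frename f) (frename g)
  | Neg f => Neg (frename f)
  | All k f => All (h k) (frename f)
  end.

Lemma tval_trename (e : nat -> D) t :
  tval cst e (trename t) = tval cst (e \o h) t.
Proof. by case: t. Qed.

Lemma sat_frename (e : nat -> D) f : injective h ->
  sat mem cls cst e (frename f) <-> sat mem cls cst (e \o h) f.
Proof.
move=> h_inj; elim: f e => [t u|t u|i t|f IHf g IHg|f IHf|k f IHf] e /=;
  rewrite ?tval_trename //.
- by rewrite IHf IHg.
- by rewrite IHf.
(* Since [h] is injective, overriding the variable [h k] affects no other renamed variable. *)
- suff E x : upd e (h k) x \o h = upd (e \o h) k x.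
    by split=> sf x; [rewrite -E -IHf | rewrite IHf E].
  by apply: funext => j; rewrite /upd /= inj_eq.
Qed.
End Renaming.

(** * First-order definability over M with class parameters *)

Section Definability.
Variable M : GBC_model.
Implicit Types (e : nat -> M) (A B : (nat -> M) -> Prop) (t : (nat -> M) -> M).

Definition gbc_sat e (f : form (vclass M) void) :=
  sat (@sin M) (fun Y y => y \inc Y) (fun v : void => match v with end) e f.

(** Only the variables of even index are read, so that those of odd index are
    available for quantification. *)
Definition definable A :=
  exists f : form (vclass M) void, forall e, gbc_sat e f <-> A (fun i => e i.*2).

(** A function is given by its graph; as in de Bruijn notation, the value is variable 0 and the
    arguments move up by one. *)
Definition defterm t := definable (fun e => e 0 = t (fun i => e i.+1)).

Lemma definable_ext A B :
  (forall e, A e <-> B e) -> definable A -> definable B.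
Proof. by move=> AB [f fA]; exists f => e; rewrite fA. Qed.

Lemma definable_not A : definable A -> definable (fun e => ~ A e).
Proof. by case=> f fA; exists (Neg f) => e; rewrite -fA. Qed.

Lemma definable_and A B :
  definable A -> definable B -> definable (fun e => A e /\ B e).
Proof. by move=> [f fA] [g gB]; exists (And f g) => e; rewrite -fA -gB. Qed.

Lemma definable_imp A B :
  definable A -> definable B -> definable (fun e => A e -> B e).
Proof.
move=> dA dB; apply: definable_ext (definable_not
  (definable_and dA (definable_not dB))) => e.
by split=> [nAB a|AB [a]]; [apply: contrapT => nB; apply: nAB|apply; apply: AB].
Qed.

Lemma definable_or A B :
  definable A -> definable B -> definable (fun e => A e \/ B e).
Proof.
move=> dA dB; apply: definable_ext (definable_imp (definable_not dA) dB) => e.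
by split=> [|[] //]; case: (EM (A e)) => [|na AB]; [left | right; apply: AB].
Qed.

Lemma definable_iff A B :
  definable A -> definable B -> definable (fun e => A e <-> B e).
Proof. by move=> dA dB; apply: definable_and; apply: definable_imp. Qed.

Lemma definable_and3 A B A' : definable A -> definable B -> definable A' ->
  definable (fun e => [/\ A e, B e & A' e]).
Proof.
move=> dA dB dA'.
apply: definable_ext (definable_and dA (definable_and dB dA')) => e.
by split=> [[? []]|[]].
Qed.

Lemma definable_all (B : (nat -> M) -> M -> Prop) :
  definable (fun e => B (fun i => e i.+1) (e 0)) ->
  definable (fun e => forall x, B e x).
Proof.
(* The variable 0 to be bound goes to the odd index 1, the other even indices move down by two, and
   the odd ones move up by two to vacate 1. *)
pose h j := if odd j then j.+2 else if j is j'.+2 then j' else 1.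
have h_inj : injective h.
  move=> a b; rewrite /h; case: (boolP (odd a)); case: (boolP (odd b));
  case: a => [|[|a]] //=; case: b => [|[|b]] //=; lia.
case=> f fB; exists (All 1 (frename h f)) => e.
have E x : gbc_sat (upd e 1 x) (frename h f) <-> B (fun i => e i.*2) x.
  rewrite /gbc_sat sat_frename // [sat _ _ _ _ _]fB /=.
  suff -> : (fun i => upd e 1 x (h i.+1.*2)) = (fun i => e i.*2) by [].
  by apply: funext => i; rewrite /h /upd odd_double /=; case: i.
by split=> sf x; apply/E.
Qed.

Lemma definable_ex (B : (nat -> M) -> M -> Prop) :
  definable (fun e => B (fun i => e i.+1) (e 0)) ->
  definable (fun e => exists x, B e x).
Proof.
move=> /definable_not /(definable_all (B := fun e x => ~ B e x)) /definable_not.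
by apply: definable_ext => e; rewrite not_existsP; split=> // ?; apply: contrapT.
Qed.

Lemma definable_ex2 (B B' : (nat -> M) -> M -> Prop) :
  definable (fun e => B (fun i => e i.+1) (e 0)) ->
  definable (fun e => B' (fun i => e i.+1) (e 0)) ->
  definable (fun e => exists2 x, B e x & B' e x).
Proof.
move=> dB dB'.
apply: definable_ext (definable_ex (B := fun e x => B e x /\ B' e x)
  (definable_and dB dB')) => e.
by split=> [[x []]|[x]]; exists x.
Qed.

Lemma definable_rename (s : nat -> nat) A : injective s ->
  definable A -> definable (fun e => A (fun i => e (s i))).
Proof.
move=> s_inj [f fA].
pose h j := if odd j then j else (s j./2).*2.
have h_inj : injective h.
  move=> a b; rewrite /h; case: (boolP (odd a)); case: (boolP (odd b)); try lia.
  move=> ob oa /double_inj /s_inj; lia.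
exists (frename h f) => e; rewrite /gbc_sat sat_frename // [sat _ _ _ _ _]fA /=.
suff -> : (fun i => e (h i.*2)) = (fun i => e (s i).*2) by [].
by apply: funext => i; rewrite /h odd_double doubleK.
Qed.

Lemma defterm_shift t : defterm t -> defterm (fun e => t (fun i => e i.+1)).
Proof.
move=> dt; apply: (definable_rename (s := fun i => if i is j.+1 then j.+2 else 0)) dt.
by case=> [|i] [|j] // [->].
Qed.

(** A quantifier names the value: some x equal to [t e] satisfies [B e]. Definability at arbitrary
    terms thus reduces to definability at variables. *)
Lemma definable_app (B : (nat -> M) -> M -> Prop) t : defterm t ->
  definable (fun e => B (fun i => e i.+1) (e 0)) ->
  definable (fun e => B e (t e)).
Proof.
move=> dt dB; apply: definable_ext (definable_ex2 (B := fun e x => x = t e) dt dB) => e.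
by split=> [[x ->]|]; last exists (t e).
Qed.

Lemma defterm_var k : defterm (fun e => e k).
Proof. by exists (Eq (inl 0) (inl k.+1.*2)) => e. Qed.

Lemma defterm_cst (c : M) : defterm (fun=> c).
Proof.
(* The language has no constants for sets, so [c] enters through its singleton class, which
   comprehension yields with [c] as set parameter. *)
have [X Xc] := gbc_comprehension (gbc_axioms M) (Eq (inl 0) (inl 1)) (fun=> c).
by exists (Cls X (inl 0)) => e; rewrite -[_ = c]Xc.
Qed.

Lemma definable_mem t u :
  defterm t -> defterm u -> definable (fun e => t e \ins u e).
Proof.
move=> dt du; apply: (definable_app (B := fun e x => x \ins u e) dt).
apply: (definable_app (B := fun e y => e 0 \ins y) (defterm_shift du)).
by exists (Mem (inl 2) (inl 0)).
Qed.

Lemma definable_eq t u : defterm t -> defterm u -> definable (fun e => t e = u e).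
Proof. by move=> dt; apply: (definable_app (B := fun e x => x = u e) dt). Qed.

Lemma definable_inc t X : defterm t -> definable (fun e => t e \inc X).
Proof.
move=> dt; apply: (definable_app (B := fun e x => x \inc X) dt).
by exists (Cls X (inl 0)).
Qed.

Lemma class_of_definable (A : M -> Prop) : definable (fun e => A (e 0)) ->
  exists X : vclass M, forall x, x \inc X <-> A x.
Proof.
case=> f fA.
(* Infinity supplies some element of M, the dummy value of all variables other than 0. *)
have [x0 _] := gbc_infinity (gbc_axioms M).
have [X Xf] := gbc_comprehension (gbc_axioms M) f (fun=> x0).
by exists X => x; rewrite Xf [sat _ _ _ _ _]fA.
Qed.
End Definability.


Ltac definability :=
  repeat (cbv beta; first
    [ assumption | apply: defterm_var | apply: defterm_cst
    | apply: definable_not | apply: definable_and | apply: definable_and3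
    | apply: definable_or | apply: definable_iff | apply: definable_imp
    | apply: definable_all | apply: definable_ex | apply: definable_ex2
    | apply: definable_mem | apply: definable_eq | apply: definable_inc ]).

(** * Ordered pairs, numerals and tags *)

Section SetTheory.
Variable M : GBC_model.
Implicit Types t u : (nat -> M) -> M.

Lemma is_opair_inj (x y x' y' z : M) :
  is_opair x y z -> is_opair x' y' z -> x = x' /\ y = y'.
Proof.
move=> [u [v [up_u up_v up_z]]] [u' [v' [up_u' up_v' up_z']]].
have uv' : u = u' \/ u = v' by apply/up_z'/up_z; left.
have vv' : v = u' \/ v = v' by apply/up_z'/up_z; right.
have v'v : v' = u \/ v' = v by apply/up_z/up_z'; right.
have xx' : x = x'.
  have [eu|eu] := uv'.
    by have /up_u' [] : x \ins u' by rewrite -eu; apply/up_u; left.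
  by have /up_u [] : x' \ins u by rewrite eu; apply/up_v'; left.
subst x'; split=> //.
have yv : y = x \/ y = y'.
  have yiv : y \ins v by apply/up_v; right.
  by case: vv' => ev; move: yiv; rewrite ev; [move=> /up_u' []; left | move/up_v'].
have yv' : y' = x \/ y' = y.
  have yiv : y' \ins v' by apply/up_v'; right.
  by case: v'v => ev; move: yiv; rewrite ev; [move=> /up_u []; left | move/up_v].
by case: yv yv' => [->|] [].
Qed.

Lemma definable_opair_inc t u X : defterm t -> defterm u ->
  definable (fun e => opair_inc (t e) (u e) X).
Proof.
move=> dt du; apply: (definable_app (B := fun e x => opair_inc x (u e) X) dt).
apply: (definable_app (B := fun e y => opair_inc (e 0) y X) (defterm_shift du)).
by rewrite /opair_inc /is_opair /is_upair; definability.
Qed.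

(** The number [k] belongs to the meta-theory, so the defining formula can be built by recursion on
    it. *)
Lemma definable_is_num k t : defterm t -> definable (fun e => is_num k (t e)).
Proof.
elim: k t => [|k IHk] t dt; apply: (definable_app (B := fun e x => is_num _ x) dt).
  by rewrite /is_num /is_empty; definability.
apply: (definable_ex2 (B := fun e y => is_num k y) (B' := fun e y => is_succ y (e 0))).
  by apply: IHk; definability.
by rewrite /is_succ; definability.
Qed.

Lemma definable_tag k (i j : nat) : definable (fun e : nat -> M => tag k (e i) (e j)).
Proof.
apply: definable_ex2; first exact/definable_is_num/defterm_var.
by rewrite /is_opair /is_upair; definability.
Qed.

Lemma definable_tag2 k (i j l : nat) :
  definable (fun e : nat -> M => tag2 k (e i) (e j) (e l)).
Proof.
apply: definable_ex2; last exact: definable_tag.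
by rewrite /is_opair /is_upair; definability.
Qed.
End SetTheory.

(** * Names as elements of M, and induction on names *)

Section Names.
Variables (M : GBC_model) (P : forcing_notion M) (d : name P).
Implicit Types t u : (nat -> M) -> M.

(** The default [d] makes the map total, so that a quantifier over names becomes a quantifier over
    M. *)
Definition to_name (x : M) : name P :=
  if pselect (is_name P x) is left h then exist _ x h else d.

Lemma to_nameK x : is_name P x -> sval (to_name x) = x.
Proof. by rewrite /to_name; case: pselect. Qed.

Lemma svalK (sigma : name P) : to_name (sval sigma) = sigma.
Proof.
case: sigma => x xP /=; rewrite /to_name; case: pselect => // xP'.
by rewrite (Prop_irrelevance xP xP').
Qed.

Lemma definable_is_name t : defterm t -> definable (fun e => is_name P (t e)).
Proof.
move=> dt; apply: (definable_app (B := fun e x => is_name P x) dt).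
by rewrite /is_name /is_opair /is_upair; definability.
Qed.

Lemma defterm_to_name t : defterm t -> defterm (fun e => sval (to_name (t e))).
Proof.
move=> dt.
apply: (definable_app (B := fun e x => e 0 = sval (to_name x)) (defterm_shift dt)).
(* Variable 0 is the argument and variable 1 the value; an argument that is not a name has value
   [d]. *)
apply: (@definable_ext _ (fun e => (is_name P (e 0) -> e 1 = e 0) /\
  (~ is_name P (e 0) -> e 1 = sval d))).
  move=> e; rewrite /to_name; case: pselect => h /=.
    by split=> [[/(_ h)]|-> //].
  by split=> [[_ /(_ h)]|-> //].
have dn := definable_is_name (defterm_var M 0).
by definability.
Qed.

Lemma definable_all_name (B : (nat -> M) -> name P -> Prop) :
  definable (fun e => B (fun i => e i.+1) (to_name (e 0))) ->
  definable (fun e => forall sigma, B e sigma).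
Proof.
move=> /(definable_all (B := fun e x => B e (to_name x))).
apply: definable_ext => e; split=> [Be sigma|Be x //].
by rewrite -[sigma]svalK.
Qed.

Lemma definable_ex_name (B : (nat -> M) -> name P -> Prop) :
  definable (fun e => B (fun i => e i.+1) (to_name (e 0))) ->
  definable (fun e => exists sigma, B e sigma).
Proof.
move=> /(definable_ex (B := fun e x => B e (to_name x))).
apply: definable_ext => e; split=> [[x Bx]|[sigma Bs]]; first by exists (to_name x).
by exists (sval sigma); rewrite svalK.
Qed.

(** A class without minimal element for the relation "rho is in the domain of
    sigma" becomes one without minimal element for membership once the sets
    having an element, or an element of an element, in it are added. *)
Lemma name_ind (A : name P -> Prop) : definable (fun e => A (to_name (e 0))) ->
  (forall sigma, (forall rho r, opair_ins (sval rho) r (sval sigma) -> A rho) ->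
    A sigma) -> forall sigma, A sigma.
Proof.
move=> dA IH sigma; apply: contrapT => nA.
pose B x := is_name P x /\ ~ A (to_name x).
have dB i : definable (fun e => B (e i)).
  apply: (definable_app (B := fun e => B)); first exact: defterm_var.
  by have dn := definable_is_name (defterm_var M 0); definability.
have [X XB] : exists X : vclass M, forall z, z \inc X <->
    B z \/ (exists2 x, B x & x \ins z) \/
    (exists y, (exists2 x, B x & x \ins y) /\ y \ins z).
  by apply: class_of_definable; definability; apply: dB.
have [|z zX z_min] := gbc_foundation (gbc_axioms M) (X := X).
  by exists (sval sigma); apply/XB; left; split; [apply: svalP | rewrite svalK].
case/XB: (zX) => [[zP nAz]|[[x xB xz]|[u [xu uz]]]].
- apply: nAz; apply: IH => rho r [w [u [v [up_u _ up_w]]] wz].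
  rewrite to_nameK // in wz.
  apply: contrapT => nArho; apply: z_min wz _; apply/XB; right; right.
  exists u; split; last by apply/up_w; left.
  exists (sval rho); last by apply/up_u; left.
  by split; [apply: svalP | rewrite svalK].
- by apply: z_min xz _; apply/XB; left.
- by apply: z_min uz _; apply/XB; right; left.
Qed.

End Names.

(** * Definability of codes and of forcing for a fixed standard formula *)

Section Codes.
Variables (M : GBC_model) (P : forcing_notion M) (n : nat).

(** An index map: the code is read at variable [a], and the parameters from variable [m] on, past
    the newly quantified variables. *)
Definition lift a m i := if i is j.+1 then m + j else a.

Lemma definable_lift a m (A : (nat -> M) -> Prop) : a < m ->
  definable A -> definable (fun e => A (fun i => e (lift a m i))).
Proof. by move=> am; apply: definable_rename => -[|i] [|j] //=; lia. Qed.

Lemma definable_tbind c (s : (nat -> M) -> nat -> term (name P)) :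
  (forall i, definable (fun e => tcodes (s (fun j => e j.+1) i) (e 0))) ->
  forall t : term void,
    definable (fun e => tcodes (tbind (s (fun j => e j.+1)) c t) (e 0)).
Proof. by move=> ds [i|[]]; apply: ds. Qed.

(** The induction is on a formula of the meta-theory, while the substituted terms vary definably
    with [e]. A binder changes [s] only at [k], where it puts a fixed variable, whose code is
    definable. *)
Lemma definable_codes (f : form 'I_n.+1 void) c
    (s : (nat -> M) -> nat -> term (name P)) :
  (forall i, definable (fun e => tcodes (s (fun j => e j.+1) i) (e 0))) ->
  definable (fun e => codes (fbind (s (fun j => e j.+1)) c f) (e 0)).
Proof.
elim: f s => [t u|t u|i t|f IHf g IHg|f IHf|k f IHf] s ds /=.
- have dt := definable_tbind c ds.
  (* With both quantifiers open, variable 0 is the second component, 1 the first, 2 the whole code,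
     and the parameters start at 3. *)
  do 2![apply: definable_ex]; apply: definable_and3; last exact: definable_tag2.
    exact: (@definable_lift 1 3 _ _ (dt t)).
  exact: (@definable_lift 0 3 _ _ (dt u)).
- have dt := definable_tbind c ds.
  do 2![apply: definable_ex]; apply: definable_and3; last exact: definable_tag2.
    exact: (@definable_lift 1 3 _ _ (dt t)).
  exact: (@definable_lift 0 3 _ _ (dt u)).
- have dt := definable_tbind c ds.
  do 2![apply: definable_ex]; apply: definable_and3; last exact: definable_tag2.
    exact/definable_is_num/defterm_var.
  exact: (@definable_lift 0 3 _ _ (dt t)).
- do 2![apply: definable_ex]; apply: definable_and3; last exact: definable_tag2.
    exact: (@definable_lift 1 3 _ _ (IHf s ds)).
  exact: (@definable_lift 0 3 _ _ (IHg s ds)).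
- apply: definable_ex2; last exact: definable_tag.
  exact: (@definable_lift 0 2 _ _ (IHf s ds)).
- do 2![apply: definable_ex]; apply: definable_and3; last exact: definable_tag2.
    exact/definable_is_num/defterm_var.
  apply: (@definable_lift 0 3 _ _ (IHf (fun e => upd (s e) k (inl k)) _)) => // i.
  rewrite /upd; case: eqP => // _ /=.
  apply: definable_ex2; first exact/definable_is_num/defterm_var.
  exact: definable_tag.
Qed.

(** With the formula fixed and the condition and names varying, forcing is a definable relation on
    M. This provides the classes to which genericity and induction on names are applied. *)
Lemma definable_rforces R (f : form 'I_n.+1 void)
    (s : (nat -> M) -> nat -> name P) t :
  (forall i, defterm (fun e => sval (s e i))) -> defterm t ->
  definable (fun e => rforces R (t e) (inst (s e) f)).
Proof.
move=> ds dt.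
apply: (definable_app (B := fun e x => rforces R x (inst (s e) f)) dt).
apply: definable_ex2; last by apply: definable_opair_inc; definability.
apply: (@definable_lift 0 2 _ _ (definable_codes (s := fun e i => inr (s e i)) _ _ _)) => // i /=.
apply: (definable_app (B := fun e x => tag 1 x (e 0)) (defterm_shift (ds i))).
exact: definable_tag.
Qed.
End Codes.

(** * Composition of substitutions *)

Lemma tbind_tbind C (g h : nat -> term C) (c : void -> C) t :
  tbind g id (tbind h c t) = tbind (fun i => tbind g id (h i)) c t.
Proof. by case: t => [i|[]]. Qed.

(** By hypothesis [h] sends each variable to itself or to a constant, so no other variable turns
    into the bound one and the updates commute with composition. *)
Lemma fbind_fbind I C (g h : nat -> term C) (c : void -> C) (f : form I void) :
  (forall i j, h i = inl j -> j = i) ->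
  fbind g id (fbind h c f) = fbind (fun i => tbind g id (h i)) c f.
Proof.
elim: f g h => [t u|t u|i t|f IHf g' IHg|f IHf|k f IHf] g h hv /=;
  rewrite ?tbind_tbind ?IHf ?IHg //;
  last by move=> i j; rewrite /upd; case: eqP => [-> []|_ /hv].
congr (All _ (fbind _ _ _)); apply: funext => i; rewrite /upd.
case: (i =P k) => /= [_|ik]; first by rewrite eqxx.
by case hi: (h i) => [j|//] /=; rewrite (hv _ _ hi); case: eqP.
Qed.

(** The left side is what the clause for universal formulas makes of [inst s (All k f)]. Rewriting
    it as an instance of [f] permits induction on [f] with [s] arbitrary. *)
Lemma subst_inst I C (f : form I void) (s : nat -> C) k c :
  subst k c (fbind (upd (fun i => inr (s i)) k (inl k))
    (fun v : void => match v with end) f) = inst (upd s k c) f.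
Proof.
rewrite /subst fbind_fbind => [|i j].
  congr fbind; apply: funext => i; rewrite /upd.
  by case: (i =P k) => /= [_|//]; rewrite eqxx.
by rewrite /upd; case: eqP => [-> []|].
Qed.

(** * Forced equality and membership of names *)

Section TruthLemma.
Variables (M : GBC_model) (P : forcing_notion M) (n : nat).
Variables (Gamma : 'I_n.+1 -> class_name P) (phi : form 'I_n.+1 void).
Variable F : forcing_relation Gamma phi.
Implicit Types (p q r : M) (sigma tau rho : name P) (f : form 'I_n.+1 void).
Implicit Types s : nat -> name P.

Local Notation "p <=P q" := (fle P p q) (at level 70).
Local Notation "p ||- f" := (@rforces M P n (fr_class F) p f) (at level 75).
Local Notation "sigma =c tau" := (Eq (inr sigma) (inr tau)) (at level 70).
Local Notation "sigma \inn tau" := (Mem (inr sigma) (inr tau)) (at level 70).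
Local Notation sub p := (@forces_sub M P n (fr_class F) p).
Local Notation frP := (fr_clauses F).

Lemma fle_cond p q : p <=P q -> p \inc fcond P /\ q \inc fcond P.
Proof.
move=> [w pqw /forder_sub [p' [q' [p'P q'P /(is_opair_inj pqw) [-> ->]]]]].
by split.
Qed.

Lemma densely_below_le p q (A : M -> Prop) :
  q <=P p -> densely_below P p A -> densely_below P q A.
Proof. by move=> qp dA q' q'q; apply: dA; apply: fle_trans q'q qp. Qed.

Lemma densely_below_dense p (A : M -> Prop) :
  densely_below P p (fun q => densely_below P q A) -> densely_below P p A.
Proof.
move=> dA q' /dA [q qq' dq].
have [|r rq Ar] := dq q; first exact/fle_refl/(proj1 (fle_cond qq')).
by exists r => //; apply: fle_trans rq qq'.
Qed.

Lemma forces_sub_le p q sigma tau : q <=P p -> sub p sigma tau -> sub q sigma tau.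
Proof.
move=> qp st rho r rs q' q'q; apply: st rs _ _; exact: fle_trans q'q qp.
Qed.

Lemma forces_eq_le p q sigma tau : q <=P p -> p ||- sigma =c tau -> q ||- sigma =c tau.
Proof.
move=> qp; have [qP pP] := fle_cond qp.
rewrite (fr_eq frP) // (fr_eq frP) // => -[st ts].
by split; apply: forces_sub_le qp _.
Qed.

Lemma forces_eq_sym p sigma tau : p \inc fcond P ->
  p ||- sigma =c tau -> p ||- tau =c sigma.
Proof. by move=> pP; rewrite !(fr_eq frP) // => -[]. Qed.

Lemma forces_mem_witness p sigma tau rho r :
  opair_ins (sval rho) r (sval tau) -> p <=P r -> p ||- sigma =c rho ->
  p ||- sigma \inn tau.
Proof.
move=> rt pr s_eq; have [pP _] := fle_cond pr.
apply/(fr_mem frP) => // q qp; exists q; first exact/fle_refl/(proj1 (fle_cond qp)).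
by exists rho, r; split=> //; [apply: fle_trans qp pr | apply: forces_eq_le qp _].
Qed.

(** Transitivity is assumed only for middle names in the domain of [tau], so that the lemma serves
    both inside the induction proving transitivity and after it. *)
Lemma forces_mem_sub p sigma tau tau' : p \inc fcond P ->
  (forall q rho rho', q <=P p -> (exists r, opair_ins (sval rho) r (sval tau)) ->
    q ||- sigma =c rho -> q ||- rho =c rho' -> q ||- sigma =c rho') ->
  p ||- sigma \inn tau -> sub p tau tau' -> exists2 q, q <=P p & q ||- sigma \inn tau'.
Proof.
move=> pP eq_trans /(fr_mem frP)-/(_ pP) /(_ p (fle_refl pP)).
move=> [q qp [rho [r [rt qr s_eq]]]] /(_ rho r rt q qp qr) [q1 q1q].
have [q1P _] := fle_cond q1q.
move=> /(fr_mem frP)-/(_ q1P) /(_ q1 (fle_refl q1P)).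
move=> [q2 q2q1 [rho' [r' [r't' q2r' r_eq]]]].
have q2q := fle_trans q2q1 q1q.
have q2p := fle_trans q2q qp.
exists q2 => //; apply: forces_mem_witness r't' q2r' _.
by apply: eq_trans r_eq => //; [exists r | apply: forces_eq_le q2q _].
Qed.

Lemma definable_forces_eq d (t1 t2 t : (nat -> M) -> M) :
  defterm t1 -> defterm t2 -> defterm t ->
  definable (fun e => t e ||- to_name d (t1 e) =c to_name d (t2 e)).
Proof.
move=> d1 d2 dt.
apply: (definable_rforces _ (Eq (inl 0) (inl 1))
  (s := fun e i => if i is 0 then to_name d (t1 e) else to_name d (t2 e))) => //.
by case=> [|i]; apply: defterm_to_name.
Qed.

Lemma forces_eq_refl p sigma : p \inc fcond P -> p ||- sigma =c sigma.
Proof.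
move: p; move: (sigma); apply: (name_ind (d := sigma)) => [|tau IH p pP].
  apply: definable_all; apply: definable_imp; first by definability.
  by apply: definable_forces_eq; definability.
suff tt : sub p tau tau by apply/(fr_eq frP).
move=> rho r rt q' q'p q'r; have [q'P _] := fle_cond q'p.
exists q'; first exact: fle_refl.
exact: forces_mem_witness rt q'r (IH _ _ rt _ q'P).
Qed.

(** Induction on the middle name, the outer ones being arbitrary: elements of the outer names are
    compared through elements of [sigma], to which the induction hypothesis applies. *)
Lemma forces_eq_trans p rho sigma tau : p \inc fcond P ->
  p ||- rho =c sigma -> p ||- sigma =c tau -> p ||- rho =c tau.
Proof.
move: p rho tau; move: (sigma).
apply: (name_ind (d := sigma)) => [|{}sigma IH p rho tau pP].
  apply: definable_all; do 2!apply: definable_all_name.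
  by do 3?[apply: definable_imp]; do ?[apply: definable_forces_eq]; definability.
have sub_trans pi pi' : sub p pi sigma -> sub p sigma pi' -> sub p pi pi'.
  move=> ps sp' nu r nr q' q'p q'r.
  have [q qq' nu_s] := ps nu r nr q' q'p q'r.
  have [qP _] := fle_cond qq'; have qp := fle_trans qq' q'p.
  have [|q1 q1q nu_p'] := forces_mem_sub qP _ nu_s (forces_sub_le qp sp').
    by move=> r' nu1 nu2 r'q [u /IH]; apply; case/fle_cond: r'q.
  by exists q1 => //; apply: fle_trans q1q qq'.
rewrite !(fr_eq frP) // => -[rs sr] [st ts]; split; exact: sub_trans.
Qed.

Lemma forces_mem_le p q sigma tau :
  q <=P p -> p ||- sigma \inn tau -> q ||- sigma \inn tau.
Proof.
move=> qp; have [qP pP] := fle_cond qp.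
by rewrite !(fr_mem frP) //; apply: densely_below_le.
Qed.

Lemma forces_mem_congr p sigma sigma' tau tau' : p \inc fcond P ->
  p ||- sigma =c sigma' -> p ||- tau =c tau' ->
  p ||- sigma \inn tau -> p ||- sigma' \inn tau'.
Proof.
move=> pP ss' /(fr_eq frP)-/(_ pP) [tt' _] st.
apply/(fr_mem frP) => //; apply: densely_below_dense => q qp.
have [qP _] := fle_cond qp.
(* The inclusion of [tau] in [tau'] is applied to [sigma'], whose membership in [tau] follows by
   replacing [sigma] in the witnesses. *)
have [||r rq] := forces_mem_sub (sigma := sigma') (tau := tau) qP _ _ (forces_sub_le qp tt').
- by move=> q1 rho rho' /fle_cond [q1P _] _; apply: forces_eq_trans.
- apply/(fr_mem frP) => // q1 q1q; have q1p := fle_trans q1q qp.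
  have /(_ q1 q1p) [q2 q2q1 [rho [u [ru q2u s_eq]]]] := (fr_mem frP _ _ pP).1 st.
  have [q2P _] := fle_cond q2q1; exists q2 => //; exists rho, u; split=> //.
  apply: forces_eq_trans s_eq => //; apply: forces_eq_sym => //.
  exact: forces_eq_le (fle_trans q2q1 q1p) ss'.
by have [rP _] := fle_cond rq; move=> /(fr_mem frP)-/(_ rP); exists r.
Qed.

Lemma forces_cls_congr p i sigma sigma' : p \inc fcond P ->
  p ||- sigma =c sigma' -> p ||- Cls i (inr sigma) -> p ||- Cls i (inr sigma').
Proof.
move=> pP ss'; rewrite !(fr_cls frP) // => si q' /[dup] q'p /si.
move=> [q qq' [tau [r [tr qr s_eq]]]]; have [qP _] := fle_cond qq'.
exists q => //; exists tau, r; split=> //; apply: forces_eq_trans s_eq => //.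
by apply: forces_eq_sym => //; apply: forces_eq_le (fle_trans qq' q'p) ss'.
Qed.

(** * Monotonicity and density for instances of standard formulas *)

Lemma forces_le f s p q : fr_dom F (inst s f) ->
  q <=P p -> p ||- inst s f -> q ||- inst s f.
Proof.
elim: f s p q => [[i|[]] [j|[]]|[i|[]] [j|[]]|i [j|[]]|f IHf g IHg|f IHf|k f IHf]
  s p q df qp; have [qP pP] := fle_cond qp.
- exact: forces_mem_le.
- exact: forces_eq_le.
- by rewrite !(fr_cls frP) //; apply: densely_below_le.
- rewrite !(fr_and frP) // => -[pf pg].
  have [df1 df2] := (sc_andl (fr_closed F) df, sc_andr (fr_closed F) df).
  by split; [apply: IHf qp pf | apply: IHg qp pg].
- rewrite !(fr_neg frP) // => nf [r rq rf]; apply: nf; exists r => //.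
  exact: fle_trans rq qp.
- rewrite !(fr_all frP) // => pf sigma; move: (pf sigma).
  have := sc_all (fr_closed F) df sigma.
  by rewrite subst_inst => dfs; apply: IHf qp.
Qed.

Lemma forces_dense f s p : fr_dom F (inst s f) -> p \inc fcond P ->
  densely_below P p (fun q => q ||- inst s f) -> p ||- inst s f.
Proof.
elim: f s p => [[i|[]] [j|[]]|[i|[]] [j|[]]|i [j|[]]|f IHf g IHg|f IHf|k f IHf]
  s p df pP dp.
- rewrite (fr_mem frP) //; apply: densely_below_dense => q' /dp [q qq'].
  by have [qP _] := fle_cond qq'; rewrite (fr_mem frP) //; exists q.
- have sub_dense sigma tau : densely_below P p (fun q => sub q sigma tau) -> sub p sigma tau.
    move=> st rho r rs q' q'p q'r; have [q qq' /(_ _ _ rs)] := st q' q'p.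
    have [qP _] := fle_cond qq'.
    move=> /(_ q (fle_refl qP) (fle_trans qq' q'r)) [q1 q1q q1f].
    by exists q1 => //; apply: fle_trans q1q qq'.
  by rewrite (fr_eq frP) //; split; apply: sub_dense => q' /dp [q qq'];
    have [qP _] := fle_cond qq'; rewrite (fr_eq frP) // => -[]; exists q.
- rewrite (fr_cls frP) //; apply: densely_below_dense => q' /dp [q qq'].
  by have [qP _] := fle_cond qq'; rewrite (fr_cls frP) //; exists q.
- have [df1 df2] := (sc_andl (fr_closed F) df, sc_andr (fr_closed F) df).
  by rewrite (fr_and frP) //; split; [apply: IHf | apply: IHg] => // q' /dp [q qq'];
    have [qP _] := fle_cond qq'; rewrite (fr_and frP) // => -[]; exists q.
(* An extension forcing [f] would have a further one forcing its negation, yet by monotonicity that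
   one forces [f] too. *)
- rewrite (fr_neg frP) // => -[q qp qf]; have [r rq] := dp q qp.
  have [rP _] := fle_cond rq.
  rewrite (fr_neg frP) // => -[]; exists r; first exact: fle_refl.
  exact: forces_le (sc_neg (fr_closed F) df) rq qf.
- rewrite (fr_all frP) // => sigma; have := sc_all (fr_closed F) df sigma.
  rewrite subst_inst => dfs; apply: IHf => // q' /dp [q qq'].
  have [qP _] := fle_cond qq'; rewrite (fr_all frP) // => /(_ sigma).
  by rewrite subst_inst; exists q.
Qed.

(** * The generic extension and truth in it *)

Variables (G : M -> Prop) (G_generic : is_generic P G).
Let G_filter : is_filter P G := proj1 G_generic.

(** Genericity concerns classes of M; comprehension turns the definable predicate into one, cut down
    to conditions. *)
Lemma generic_mem (A : M -> Prop) : definable (fun e => A (e 0)) ->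
  (forall p, p \inc fcond P -> exists2 q, q <=P p & A q) -> exists2 p, G p & A p.
Proof.
move=> dA A_dense.
have [|D DA] := class_of_definable (A := fun p => p \inc fcond P /\ A p).
  by definability.
have [|p Gp /DA []] := proj2 G_generic D; last by exists p.
split=> [p /DA []//|p /A_dense [q qp Aq]].
by exists q => //; apply/DA; split=> //; case/fle_cond: qp.
Qed.

Lemma eqG_refl sigma : eqG F G sigma sigma.
Proof.
have [p Gp] := filter_nonempty G_filter.
exists p => //; exact/forces_eq_refl/(filter_sub G_filter).
Qed.

(** This amounts to [eqG] being an equivalence relation; for transitivity, the two witnesses have a
    common extension in [G]. *)
Lemma ext_cls_eq sigma tau : ext_cls F G sigma = ext_cls F G tau <-> eqG F G sigma tau.
Proof.
have eqG_sym rho rho' : eqG F G rho rho' -> eqG F G rho' rho.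
  by move=> [p Gp pe]; exists p => //; apply: forces_eq_sym (filter_sub G_filter Gp) pe.
have eqG_trans rho rho' rho'' : eqG F G rho rho' -> eqG F G rho' rho'' -> eqG F G rho rho''.
  move=> [p Gp pe] [q Gq qe]; have [r [Gr rp rq]] := filter_down G_filter Gp Gq.
  exists r => //; apply: forces_eq_trans (filter_sub G_filter Gr) _ (forces_eq_le rq qe).
  exact: forces_eq_le rp pe.
split=> [[->]|st]; first exact: eqG_refl.
apply: eq_exist; apply: funext => rho; apply: propext.
by split=> [/(eqG_trans _ _ _ (eqG_sym _ _ st))|/(eqG_trans _ _ _ st)].
Qed.

(** [ext_mem] may use other representatives; a condition in [G] below all three witnesses carries
    membership over by congruence. *)
Lemma ext_mem_cls sigma tau :
  ext_mem (ext_cls F G sigma) (ext_cls F G tau) <-> memG F G sigma tau.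
Proof.
split=> [|st]; last by exists sigma, tau.
move=> [sigma' [tau' [/esym/ext_cls_eq [p Gp pe] /esym/ext_cls_eq [q Gq qe] [r Gr rm]]]].
have [u [Gu up uq]] := filter_down G_filter Gp Gq.
have [v [Gv vu vr]] := filter_down G_filter Gu Gr.
exists v => //; apply: forces_mem_congr (forces_mem_le vr rm).
- exact: filter_sub Gv.
- exact: forces_eq_le (fle_trans vu up) pe.
- exact: forces_eq_le (fle_trans vu uq) qe.
Qed.

Lemma ext_pred_cls i sigma : ext_pred (F := F) i (ext_cls F G sigma) <-> clsG F G i sigma.
Proof.
split=> [|si]; last by exists sigma.
move=> [sigma' /esym/ext_cls_eq [p Gp pe] [r Gr rm]].
have [v [Gv vp vr]] := filter_down G_filter Gp Gr.
have vP := filter_sub G_filter Gv.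
exists v => //; apply: forces_cls_congr (forces_eq_le vp pe) _ => //.
(* The atom is seen as an instance with variable 0 sent to [sigma'], which brings it under
   monotonicity. *)
exact: (forces_le (f := Cls i (inl 0)) (s := fun=> sigma') (ca_cls (fr_atomic F) _ _) vr rm).
Qed.

Lemma truth_lemma f s : fr_dom F (inst s f) ->
  ext_sat (fun i => ext_cls F G (s i)) f <-> exists2 p, G p & p ||- inst s f.
Proof.
have GP p : G p -> p \inc fcond P by apply: filter_sub G_filter _.
(* Conditions in [G] are compatible, so if one forces a formula, every other has an extension
   forcing it. *)
have compat f' s' p q : fr_dom F (inst s' f') -> G p -> G q -> p ||- inst s' f' ->
    exists2 r, r <=P q & r ||- inst s' f'.
  move=> df Gp Gq pf; have [r [Gr rp rq]] := filter_down G_filter Gp Gq.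
  by exists r => //; apply: forces_le df rp pf.
rewrite /ext_sat.
elim: f s => [[i|[]] [j|[]]|[i|[]] [j|[]]|i [j|[]]|f IHf g IHg|f IHf|k f IHf] s df /=.
- exact: ext_mem_cls.
- exact: ext_cls_eq.
- exact: ext_pred_cls.
- have [df1 df2] := (sc_andl (fr_closed F) df, sc_andr (fr_closed F) df).
  rewrite IHf // IHg //; split=> [[[p Gp pf] [q Gq qg]]|[p Gp]].
    have [r [Gr rp rq]] := filter_down G_filter Gp Gq; exists r => //.
    apply/(fr_and frP); [exact: GP | done | split].
      exact: forces_le df1 rp pf.
    exact: forces_le df2 rq qg.
  by move=> /(fr_and frP)-/(_ (GP _ Gp) df) [pf pg]; split; exists p.
- have df1 := sc_neg (fr_closed F) df; rewrite IHf //; split=> [nf|[p Gp pn] [q Gq qf]].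
    have [||p Gp [pf|pn]] := @generic_mem (fun p => p ||- inst s f \/
        ~ exists2 q, q <=P p & q ||- inst s f).
    + apply: definable_or.
        by apply: definable_rforces => [i|]; definability.
      apply: definable_not; apply: definable_ex2.
        by apply: definable_opair_inc; definability.
      by apply: definable_rforces => [i|]; definability.
    + move=> p pP; case: (EM (exists2 q, q <=P p & q ||- inst s f)) => [[q qp qf]|pn].
        by exists q => //; left.
      by exists p; [apply: fle_refl | right].
    + by case: nf; exists p.
    + by exists p => //; apply/(fr_neg frP) => //; apply: GP.
  by move/(fr_neg frP): pn => /(_ (GP _ Gp) df); apply; apply: compat Gq Gp qf.
- have dfs sigma : fr_dom F (inst (upd s k sigma) f).
    by have := sc_all (fr_closed F) df sigma; rewrite subst_inst.
  have updE sigma : upd (fun i => ext_cls F G (s i)) k (ext_cls F G sigma) =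
      fun i => ext_cls F G (upd s k sigma i).
    by apply: funext => i; rewrite /upd; case: eqP.
  have allE p : p \inc fcond P -> p ||- inst s (All k f) <->
      forall sigma, p ||- inst (upd s k sigma) f.
    move=> pP; rewrite (fr_all frP) //.
    by split=> pf sigma; move: (pf sigma); rewrite subst_inst.
  split=> [sf|[p Gp /(allE _ (GP _ Gp)) pf] [X [sigma defX]]]; last first.
    have -> : exist _ X (ex_intro _ sigma defX) = ext_cls F G sigma by apply: eq_exist.
    by rewrite updE IHf //; exists p.
  have [||p Gp [pf|[sigma pn]]] := @generic_mem (fun p => p ||- inst s (All k f) \/
      exists sigma, ~ exists2 q, q <=P p & q ||- inst (upd s k sigma) f).
  + apply: definable_or.
      by apply: definable_rforces => [i|]; definability.
    (* Here [s 0] is merely a default for elements of M that are not names. *)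
    apply: (definable_ex_name (d := s 0)); apply: definable_not; apply: definable_ex2.
      by apply: definable_opair_inc; definability.
    apply: definable_rforces => [i|]; last by definability.
    by rewrite /upd; case: (i == k); [apply: defterm_to_name|]; definability.
  + move=> p pP; case: (EM (p ||- inst s (All k f))) => [pf|npf].
      by exists p; [apply: fle_refl | left].
    have /existsNP [sigma nps] : ~ forall sigma, p ||- inst (upd s k sigma) f.
      by move=> /(allE _ pP).
    (* By the density lemma, not forcing the instance at [sigma] yields some q below p with no
       extension forcing it; this q lies in the class. *)
    have /existsNP [q] : ~ densely_below P p (fun q => q ||- inst (upd s k sigma) f).
      by move=> /(forces_dense (dfs sigma) pP).
    by move=> /not_implyP [qp nq]; exists q => //; right; exists sigma.
  + by exists p.
  (* Some condition in [G] forces the instance at [sigma], and its compatibility with p contradicts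
     the choice of p. *)
  + case: pn; have := sf (ext_cls F G sigma).
    by rewrite updE IHf // => -[q Gq qf]; apply: compat Gq Gp qf.
Qed.
End TruthLemma.

Theorem theorem7 (M : GBC_model) (P : forcing_notion M) (n : nat)
    (Gamma : 'I_n.+1 -> class_name P) (phi : form 'I_n.+1 void)
    (F : forcing_relation Gamma phi) (G : M -> Prop) (hG : is_generic P G)
    (tau : nat -> name P) :
  ext_sat (fun k : nat => ext_cls F G (tau k)) phi <->
  exists2 p : M, G p & forces F p (inst tau phi).
Proof. exact: (truth_lemma hG (fr_inst F tau)). Qed.
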